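(* Let $B$ be a finite antichain in the poset of equivalence relations on finite sets under the non-consecutive embedding order, and let $C=\mathrm{Av}(B)$ (so that $C$ is a finitely based avoidance set with basis $B$). Then $C$ is atomic if and only if all elements of $B$ are uniform.
   Context: An equivalence relation is a pair $(X,\rho)$ where $X$ is a set and $\rho\subseteq X\times X$ is reflexive, symmetric and transitive. The non-consecutive embedding order is defined by: $(X,\rho)\le (Y,\sigma)$ if and only if there is an injective function $f:X\to Y$ such that for all $x,y\in X$, $(x,y)\in\rho$ if and only if $(f(x),f(y))\in\sigma$. Two equivalence relations are isomorphic if there is a bijection between the underlying sets that preserves and reflects the relation; isomorphic equivalence relations are considered equal, so the equivalence relations on finite sets form a poset under $\le$. For a set $B$ of elements of a poset $P$, $\mathrm{Av}(B)=\{x\in P : y\not\le x \text{ for all } y\in B\}$. A subset is downward closed if it contains every element below any of its elements. The basis of a downward closed set $C$ is the set of minimal elements of the complement of $C$; here it is the unique antichain $B$ with $C=\mathrm{Av}(B)$. A downward closed set $C$ is atomic if $C$ cannot be expressed as a union of two downward closed proper subsets of $C$. Equivalently, $C$ satisfies the joint embedding property: for all $x,y\in C$ there is $z\in C$ with $x\le z$ and $y\le z$. An equivalence relation is uniform if all its equivalence classes have the same size. *)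

(* Defs.v *)
From HB Require Import structures.
From mathcomp Require Import all_boot all_order.
From mathcomp Require classical_sets cardinality.

Set Implicit Arguments.
Unset Strict Implicit.
Unset Printing Implicit Defensive.

Import Order.TTheory.

Local Open Scope quotient_scope.

Section FiniteRelations.
Implicit Types X Y Z : finType.

Definition is_equivalence X (rho : {set X * X}) : bool :=
  [&& [forall x, (x, x) \in rho],
      [forall x, forall y, ((x, y) \in rho) ==> ((y, x) \in rho)]
    & [forall x, forall y, forall z,
        ((x, y) \in rho) && ((y, z) \in rho) ==> ((x, z) \in rho)]].

Definition embeds X Y (rho : {set X * X}) (sigma : {set Y * Y}) : bool :=
  [exists f : {ffun X -> Y}, injectiveb f &&
    [forall x, forall y, ((x, y) \in rho) == ((f x, f y) \in sigma)]].

Definition isomorphic X Y (rho : {set X * X}) (sigma : {set Y * Y}) : bool :=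
  [exists f : {ffun X -> Y}, injectiveb f && [forall y, y \in codom f] &&
    [forall x, forall y, ((x, y) \in rho) == ((f x, f y) \in sigma)]].

Definition eq_classes X (rho : {set X * X}) : {set {set X}} :=
  equivalence_partition (fun x y => (x, y) \in rho) [set: X].

Definition is_uniform X (rho : {set X * X}) : Prop :=
  {in eq_classes rho &, forall A B : {set X}, #|A| = #|B|}.

Lemma is_equivalenceP X (rho : {set X * X}) :
  reflect [/\ reflexive (fun x y => (x, y) \in rho),
              symmetric (fun x y => (x, y) \in rho)
            & transitive (fun x y => (x, y) \in rho)]
          (is_equivalence rho).
Proof.
apply: (iffP and3P) => -[refl sym trans]; split.
- by move=> x; apply: (forallP refl).
- move=> x y; apply/idP/idP => xy.
    exact: (implyP (forallP (forallP sym x) y)).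
  exact: (implyP (forallP (forallP sym y) x)).
- move=> y x z xy yz.
  by apply: (implyP (forallP (forallP (forallP trans x) y) z)); rewrite xy yz.
- by apply/forallP.
- by apply/forallP => x; apply/forallP => y; rewrite -[_ \in _]sym implybb.
- apply/forallP => x; apply/forallP => y; apply/forallP => z; apply/implyP.
  by case/andP; apply: trans.
Qed.

Lemma embedsP X Y (rho : {set X * X}) (sigma : {set Y * Y}) :
  reflect (exists f : X -> Y, injective f /\
             forall x y, (x, y) \in rho <-> (f x, f y) \in sigma)
          (embeds rho sigma).
Proof.
apply: (iffP existsP) => [[f /andP[/injectiveP fi /forallP fr]]|[f [fi fr]]].
  by exists f; split=> // x y; rewrite (eqP (forallP (fr x) y)).
exists (finfun f); apply/andP; split.
  by apply/injectiveP => x y; rewrite !ffunE; apply: fi.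
apply/forallP => x; apply/forallP => y; rewrite !ffunE.
by apply/eqP; apply/idP/idP => /fr.
Qed.

Lemma isomorphicP X Y (rho : {set X * X}) (sigma : {set Y * Y}) :
  reflect (exists f : X -> Y, bijective f /\
             forall x y, (x, y) \in rho <-> (f x, f y) \in sigma)
          (isomorphic rho sigma).
Proof.
apply: (iffP existsP).
  move=> [f /andP[/andP[/injectiveP fi /forallP fs] /forallP fr]].
  exists f; split=> [|x y]; last by rewrite (eqP (forallP (fr x) y)).
  by exists (fun y => iinv (fs y)) => x; [apply: fi|]; rewrite f_iinv.
move=> [f [[g fK gK] fr]]; exists (finfun f); apply/andP; split.
  apply/andP; split.
    by apply/injectiveP => x y; rewrite !ffunE; apply: (can_inj fK).
  by apply/forallP => y; apply/codomP; exists (g y); rewrite ffunE gK.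
apply/forallP => x; apply/forallP => y; rewrite !ffunE.
by apply/eqP; apply/idP/idP => /fr.
Qed.

Lemma embeds_refl X (rho : {set X * X}) : embeds rho rho.
Proof. by apply/embedsP; exists id; split. Qed.

Lemma embeds_trans X Y Z (rho : {set X * X}) (sigma : {set Y * Y})
    (tau : {set Z * Z}) :
  embeds rho sigma -> embeds sigma tau -> embeds rho tau.
Proof.
move=> /embedsP[f [fi fr]] /embedsP[g [gi gr]]; apply/embedsP.
exists (g \o f); split; first exact: inj_comp.
by move=> x y; split=> [/fr/gr|/gr/fr].
Qed.

Lemma isomorphicE X Y (rho : {set X * X}) (sigma : {set Y * Y}) :
  isomorphic rho sigma = embeds rho sigma && embeds sigma rho.
Proof.
apply/isomorphicP/andP => [[f [[g fK gK] fr]]|].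
  split; apply/embedsP; [exists f|exists g]; split=> //.
  - exact: can_inj fK.
  - exact: can_inj gK.
  - by move=> x y; rewrite -{1}[x]gK -{1}[y]gK; split=> /fr.
move=> [/embedsP[f [fi fr]] /embedsP[g [gi _]]]; exists f; split=> //.
exact: (inj_card_bij fi (leq_card g gi)).
Qed.

Lemma isomorphic_uniform X Y (rho : {set X * X}) (sigma : {set Y * Y}) :
  isomorphic rho sigma -> is_uniform rho -> is_uniform sigma.
Proof.
move=> /isomorphicP[f [fb fr]] urho.
have [g fK gK] := fb; have fi := can_inj fK.
pose cls Z (tau : {set Z * Z}) z := [set w in [set: Z] | (z, w) \in tau].
have card_cls x : #|cls Y sigma (f x)| = #|cls X rho x|.
  rewrite -(card_imset _ fi); apply: eq_card => y; rewrite inE in_setT /=.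
  apply/idP/imsetP => [xy|[z + ->]].
    by exists (g y); rewrite ?inE ?gK //; apply/fr; rewrite gK.
  by rewrite inE in_setT /= => /fr.
move=> _ _ /imsetP[y _ ->] /imsetP[z _ ->].
rewrite -[y]gK -[z]gK.
have /= := card_cls (g y); rewrite /cls => ->.
have /= := card_cls (g z); rewrite /cls => ->.
by apply: urho; apply: imset_f.
Qed.

End FiniteRelations.

(* Every finite set is in bijection with some ['I_n], so the isomorphism
   classes are already represented by the relations on the sets ['I_n];
   [eqclass] below gives the class of a relation on any finite type. *)
Definition ord_equiv : Type :=
  {n : nat & {rho : {set 'I_n * 'I_n} | is_equivalence rho}}.

HB.instance Definition _ := Choice.on ord_equiv.

Definition graph (x : ord_equiv) : {set 'I_(tag x) * 'I_(tag x)} :=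
  val (tagged x).

Definition ord_isomorphic (x y : ord_equiv) : bool :=
  isomorphic (graph x) (graph y).

Lemma ord_isomorphic_refl : reflexive ord_isomorphic.
Proof. by move=> x; rewrite /ord_isomorphic isomorphicE embeds_refl. Qed.

Lemma ord_isomorphic_sym : symmetric ord_isomorphic.
Proof. by move=> x y; rewrite /ord_isomorphic !isomorphicE andbC. Qed.

Lemma ord_isomorphic_trans : transitive ord_isomorphic.
Proof.
move=> y x z; rewrite /ord_isomorphic !isomorphicE => /andP[xy yx] /andP[yz zy].
by rewrite (embeds_trans xy yz) (embeds_trans zy yx).
Qed.

Canonical ord_isomorphic_equiv :=
  EquivRel ord_isomorphic
    ord_isomorphic_refl ord_isomorphic_sym ord_isomorphic_trans.

Definition eqposet : Type := {eq_quot ord_isomorphic}.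

HB.instance Definition _ := Choice.on eqposet.
HB.instance Definition _ := EqQuotient.on eqposet.

Definition eqposet_le (a b : eqposet) : bool :=
  embeds (graph (repr a)) (graph (repr b)).

Lemma eqposet_le_refl : reflexive eqposet_le.
Proof. by move=> a; apply: embeds_refl. Qed.

Lemma eqposet_le_anti : antisymmetric eqposet_le.
Proof.
move=> a b ab; rewrite -[a]reprK -[b]reprK; apply/eqmodP.
by rewrite /= /ord_isomorphic isomorphicE.
Qed.

Lemma eqposet_le_trans : transitive eqposet_le.
Proof. by move=> b a c; apply: embeds_trans. Qed.

Fact eqposet_display : Order.disp_t. Proof. exact: Order.Disp tt tt. Qed.

HB.instance Definition _ :=
  Order.Le_isPOrder.Build eqposet_display eqposet
    eqposet_le_refl eqposet_le_anti eqposet_le_trans.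

Definition uniform (a : eqposet) : Prop := is_uniform (graph (repr a)).

Section ClassOf.
Variables (X : finType) (rho : {set X * X}) (rhoE : is_equivalence rho).

Definition rank_graph : {set 'I_#|X| * 'I_#|X|} :=
  [set p | (enum_val p.1, enum_val p.2) \in rho].

Lemma rank_graph_equivalence : is_equivalence rank_graph.
Proof.
have [refl sym trans] := is_equivalenceP _ rhoE.
apply/is_equivalenceP; split=> [i|i j|j i k]; rewrite !inE /=.
- exact: refl.
- exact: sym.
- exact: trans.
Qed.

Definition rank_equiv : ord_equiv :=
  Tagged (fun n => {tau : {set 'I_n * 'I_n} | is_equivalence tau})
    (exist _ rank_graph rank_graph_equivalence).

Definition eqclass : eqposet := \pi_eqposet rank_equiv.

Lemma isomorphic_eqclass : isomorphic rho (graph (repr eqclass)).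
Proof.
have: isomorphic rho rank_graph.
  apply/isomorphicP; exists enum_rank; split.
    by exists enum_val; [apply: enum_rankK | apply: enum_valK].
  by move=> x y; rewrite inE /= !enum_rankK.
have: ord_isomorphic rank_equiv (repr eqclass).
  by apply/(@eqmodP _ ord_isomorphic_equiv); rewrite reprK.
rewrite /ord_isomorphic /= !isomorphicE => /andP[ab ba] /andP[ca ac].
by rewrite (embeds_trans ca ab) (embeds_trans ba ac).
Qed.

End ClassOf.

Lemma eqclass_le (X Y : finType) (rho : {set X * X}) (sigma : {set Y * Y})
    (rhoE : is_equivalence rho) (sigmaE : is_equivalence sigma) :
  (eqclass rhoE <= eqclass sigmaE)%O = embeds rho sigma.
Proof.
have := isomorphic_eqclass rhoE; have := isomorphic_eqclass sigmaE.
rewrite !isomorphicE => /andP[cd dc] /andP[ab ba]; apply/idP/idP => h.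
  exact: embeds_trans (embeds_trans ab h) dc.
exact: embeds_trans (embeds_trans ba h) cd.
Qed.

Lemma eqclass_eq (X Y : finType) (rho : {set X * X}) (sigma : {set Y * Y})
    (rhoE : is_equivalence rho) (sigmaE : is_equivalence sigma) :
  (eqclass rhoE == eqclass sigmaE) = isomorphic rho sigma.
Proof. by rewrite eq_le !eqclass_le isomorphicE. Qed.

Lemma eqclass_uniform (X : finType) (rho : {set X * X})
    (rhoE : is_equivalence rho) :
  uniform (eqclass rhoE) <-> is_uniform rho.
Proof.
have iso := isomorphic_eqclass rhoE.
split; apply: isomorphic_uniform => //.
by move: iso; rewrite !isomorphicE andbC.
Qed.

Import classical_sets cardinality.

Section Posets.
Local Open Scope classical_set_scope.
Local Open Scope order_scope.
Context {d : Order.disp_t} {P : porderType d}.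

Definition antichain (B : set P) : Prop :=
  forall x y, B x -> B y -> x <= y -> x = y.

Definition Av (B : set P) : set P := [set x | forall y, B y -> ~~ (y <= x)].

Definition downward_closed (C : set P) : Prop :=
  forall x y, C x -> y <= x -> C y.

(* Meant for downward closed [C]; see [Av_downward_closed]. *)
Definition atomic (C : set P) : Prop :=
  ~ exists D E : set P, [/\ downward_closed D, downward_closed E,
                            D `<` C, E `<` C & C = D `|` E].

Lemma Av_downward_closed (B : set P) : downward_closed (Av B).
Proof.
move=> x y xB yx z Bz; apply/negP => zy.
by have /negP := xB z Bz; apply; apply: le_trans yx.
Qed.

End Posets.

(* Main.v *)
(* Arranging the classes of a finite equivalence relation as the rows of a
   Young diagram, longest first, turns the embedding order into inclusion of
   diagrams, and uniform relations into rectangles.  If every element of B is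
   a rectangle, the union of two diagrams of Av(B) is again in Av(B): a
   rectangle lies below a union as soon as its corner does, hence below one of
   the two parts.  Conversely, a non-rectangular b in B is the union of two
   smaller diagrams, which are in Av(B) since B is an antichain and have no
   common upper bound there. *)
Require Import Defs.
From mathcomp Require Import all_boot all_order.

Set Implicit Arguments.
Unset Strict Implicit.
Unset Printing Implicit Defensive.

Lemma injective_ord_unbounded n (f : 'I_n.+1 -> nat) :
  injective f -> exists k, n <= f k.
Proof.
move=> fI; apply/existsP; apply: contraT; rewrite negb_exists => /forallP fn.
have fl k : f k < n by rewrite ltnNge.
have gI : injective (fun k => Ordinal (fl k)) by move=> k l [] /fI.
by have := leq_card _ gI; rewrite !card_ord ltnn.
Qed.

(** * Young diagrams and the relation of lying in the same row *)

Local Notation cell := (nat * nat)%type.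

(** A cell is a pair of row and column. Only membership in the list matters, so repetitions are
    harmless and [++] serves as union. *)
Definition young (s : seq cell) : Prop :=
  forall i j i' j', (i, j) \in s -> i' <= i -> j' <= j -> (i', j') \in s.

Definition rectangular (s : seq cell) : Prop :=
  forall i j i' j', (i, j) \in s -> (i', j') \in s -> (i, j') \in s.

Definition row_graph (s : seq cell) : {set seq_sub s * seq_sub s} :=
  [set p | (val p.1).1 == (val p.2).1].

Lemma row_graph_equivalence s : is_equivalence (row_graph s).
Proof.
apply/is_equivalenceP; split=> [x|x y|y x z]; rewrite !inE //=.
by move=> /eqP-> /eqP->.
Qed.

(** By pigeonhole, one of the rows [0..i] is sent to a row of index at least [i], and one of its
    first [j+1] cells to a column at least [j]; that image dominates [(i, j)]. *)
Lemma row_graph_embeds s t : young s -> young t ->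
  embeds (row_graph s) (row_graph t) <-> {subset s <= t}.
Proof.
move=> ys yt; split=> [/embedsP[f [fI fr]] [i j] ij|st]; last first.
  apply/embedsP; exists (fun x => SeqSub (st _ (valP x))); split.
    by move=> x y [] /val_inj.
  by move=> x y; rewrite !inE.
have cl (k : 'I_i.+1) (l : 'I_j.+1) : ((k : nat), (l : nat)) \in s.
  by apply: ys ij _ _; rewrite -ltnS.
pose F k l := val (f (SeqSub (cl k l))).
have FE k l k' l' : ((F k l).1 == (F k' l').1) = (k == k').
  have := fr (SeqSub (cl k l)) (SeqSub (cl k' l')); rewrite !inE /=.
  by move=> h; apply/idP/idP => /h.
have [k ik] : exists k, i <= (F k ord0).1.
  apply: (@injective_ord_unbounded _ (fun k => (F k ord0).1)) => k k' /eqP.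
  by rewrite FE => /eqP.
have [l jl] : exists l, j <= (F k l).2.
  apply: (@injective_ord_unbounded _ (fun l => (F k l).2)) => l l' e2.
  have /eqP e1 : (F k l).1 == (F k l').1 by rewrite FE.
  have : F k l = F k l'.
    by rewrite [LHS]surjective_pairing e1 e2 -surjective_pairing.
  by move=> /val_inj/fI/(congr1 val)[]/val_inj.
have /eqP e : (F k ord0).1 == (F k l).1 by rewrite FE.
apply: (yt (F k l).1 (F k l).2) jl; last by rewrite -e.
by rewrite -surjective_pairing; apply: valP.
Qed.

(** In a rectangle, sliding cells along their columns injects any row into any other. If instead
    [(i, j')] is missing, row [i] has at most [j'] cells and row [i'] at least [j'+1]. *)
Lemma row_graph_uniform s : young s ->
  is_uniform (row_graph s) <-> rectangular s.
Proof.
move=> ys; split=> [us i j i' j' ij ij'|rs]; last first.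
  suff le x y : #|[set z in [set: seq_sub s] | (x, z) \in row_graph s]| <=
      #|[set z in [set: seq_sub s] | (y, z) \in row_graph s]|.
    move=> _ _ /imsetP[x _ ->] /imsetP[y _ ->].
    by apply/eqP; rewrite eqn_leq !le.
  have cl (z : seq_sub s) : ((val y).1, (val z).2) \in s.
    by apply: (rs _ (val y).2 (val z).1); rewrite -surjective_pairing; apply: valP.
  rewrite -(@card_in_imset _ _ (fun z => SeqSub (cl z))); last first.
    move=> z z'; rewrite !inE /= => /eqP xz /eqP xz' [] e.
    apply: val_inj.
    by rewrite [LHS]surjective_pairing -xz xz' e -surjective_pairing.
  apply/subset_leq_card/subsetP => _ /imsetP[z _ ->].
  by rewrite !inE /=.
apply: contraT => nij'.
have := us _ _ (imset_f _ (in_setT (SeqSub ij))) (imset_f _ (in_setT (SeqSub ij'))).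
set A := finset _; set B := finset _ => AB.
have cl (l : 'I_j'.+1) : (i', (l : nat)) \in s.
  by apply: (ys _ _ _ _ ij') => //; rewrite -ltnS.
have lB : j'.+1 <= #|B|.
  rewrite -[j'.+1]card_ord -(@card_imset _ _ (fun l => SeqSub (cl l))).
    by apply/subset_leq_card/subsetP => _ /imsetP[l _ ->]; rewrite !inE /=.
  by move=> l l' [] /val_inj.
suff : #|A| <= j' by rewrite AB leqNgt lB.
have Ai z : z \in A -> i = (val z).1 by rewrite !inE /= => /eqP.
have lA z : z \in A -> (val z).2 < j'.
  move=> /Ai zi; rewrite ltnNge; apply: contra nij' => jz.
  by apply: (ys (val z).1 _ _ _ _ _ jz); [rewrite -surjective_pairing; apply: valP|rewrite zi].
(* [inord] needs a nonempty ordinal type, hence one value too many; the image misses [ord_max],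
   which restores the bound [j']. *)
rewrite -(@card_in_imset _ _ (fun z : seq_sub s => inord (val z).2 : 'I_j'.+1) A).
  rewrite -ltnS -[X in _ < X]card_ord -cardsT; apply: proper_card.
  rewrite properE subsetT; apply/negP => /subsetP/(_ ord_max (in_setT _)).
  move=> /imsetP[z zA /(congr1 val)]; rewrite /= inordK; last exact/ltnW/lA.
  by move=> e; have := lA z zA; rewrite -e ltnn.
move=> z z' zA zA' /(congr1 val); rewrite /= !inordK; try exact/ltnW/lA.
move=> e; apply: val_inj.
by rewrite [LHS]surjective_pairing -(Ai z zA) (Ai z' zA') e -surjective_pairing.
Qed.

(** With the classes sorted by decreasing size, the row of an element is the rank of its class and
    the column its place inside the class. *)
Lemma isomorphic_row_graph (X : finType) (rho : {set X * X}) :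
  is_equivalence rho -> exists2 s, young s & isomorphic rho (row_graph s).
Proof.
move=> /is_equivalenceP[refl sym trans].
have eqR : {in [set: X] & &, equivalence_rel (fun x y => (x, y) \in rho)}.
  move=> x y z _ _ _; split=> // xy.
  by apply/idP/idP; apply: trans; rewrite // sym.
pose cls x := [set y in [set: X] | (x, y) \in rho].
have clsE x y : (cls x == cls y) = ((x, y) \in rho).
  apply/eqP/idP => [/setP/(_ y)|xy]; first by rewrite !inE refl.
  apply/setP => z; rewrite !inE /=.
  by have [_ /(_ xy)] := eqR x y z (in_setT _) (in_setT _) (in_setT _).
pose geC (A B : {set X}) := #|B| <= #|A|.
have geT : transitive geC by move=> A B C AB /leq_trans; apply.
pose L := sort geC (enum (eq_classes rho)).
have Lsort : sorted geC L by apply: sort_sorted => A B; apply: leq_total.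
have clsL x : cls x \in L by rewrite mem_sort mem_enum; apply: imset_f.
have Luniq : uniq L by rewrite sort_uniq enum_uniq.
pose pos x : cell := (index (cls x) L, index x (enum (cls x))).
have mcls x : x \in enum (cls x) by rewrite mem_enum !inE; apply: refl.
have posI : injective pos.
  move=> x y []; move/(index_inj set0 (clsL _) (clsL _)) => e; rewrite -e.
  by move/(index_inj x (mcls x)); apply; rewrite e; apply: mcls.
pose s := [seq pos x | x : X].
have poss x : pos x \in s by apply: image_f.
exists s.
  move=> i j i' j' /imageP[x _ [-> ->]] ii jj.
  have iL : i' < size L by apply: leq_ltn_trans ii _; rewrite index_mem.
  have /imsetP[y _ yE] : nth set0 L i' \in eq_classes rho.
    by rewrite -mem_enum -(mem_sort geC) mem_nth.
  (* Class [i'] comes no later than class [i], so it is at least as large and has an element in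
     place [j']. *)
  have jy : j' < size (enum (cls y)).
    apply: leq_ltn_trans jj _.
    apply: (@leq_trans (size (enum (cls x)))); first by rewrite index_mem.
    rewrite -!cardE /cls -yE -[X in #|_ X| <= _](nth_index set0 (clsL x)).
    by apply: (sorted_leq_nth geT _ set0 Lsort);
      rewrite ?inE ?index_mem // => A; apply: leqnn.
  pose z := nth x (enum (cls y)) j'.
  have /eqP yz : cls y == cls z.
    by rewrite clsE; have := mem_nth x jy; rewrite mem_enum inE => /andP[].
  apply/imageP; exists z => //; rewrite /pos -yz.
  by rewrite /z index_uniq ?enum_uniq // /cls -yE index_uniq.
apply/isomorphicP; exists (fun x => SeqSub (poss x)); split.
  apply: inj_card_bij => [x y []|]; first by move=> e1 e2; apply: posI; congr pair.
  have us : uniq s by rewrite map_inj_uniq // enum_uniq.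
  by rewrite card_seq_sub // size_map -cardE.
move=> x y; rewrite inE /= -clsE.
by split=> [/eqP->//|/eqP/(index_inj set0 (clsL _) (clsL _))->].
Qed.

(** * Elements of the poset as Young diagrams *)

Definition diagram (s : seq cell) : eqposet := eqclass (row_graph_equivalence s).

Lemma diagram_surj (a : eqposet) : exists2 s, young s & a = diagram s.
Proof.
have [s ys si] := isomorphic_row_graph (valP (tagged (repr a))).
exists s => //; have := isomorphic_eqclass (row_graph_equivalence s).
move: si; rewrite !isomorphicE => /andP[rs sr] /andP[sd ds].
apply: eqposet_le_anti.
by rewrite /eqposet_le (embeds_trans rs sd) (embeds_trans ds sr).
Qed.

Lemma diagram_le s t : young s -> young t ->
  (diagram s <= diagram t)%O <-> {subset s <= t}.
Proof. by rewrite eqclass_le; apply: row_graph_embeds. Qed.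

Lemma diagram_uniform s : young s -> uniform (diagram s) <-> rectangular s.
Proof.
by move=> ys; apply: iff_trans (eqclass_uniform _) (row_graph_uniform ys).
Qed.

(** * Unions and truncations of Young diagrams *)

Lemma young_cat s t : young s -> young t -> young (s ++ t).
Proof.
move=> ys yt i j i' j'; rewrite !mem_cat => /orP[] ij ii jj; apply/orP.
  by left; apply: ys ij ii jj.
by right; apply: yt ij ii jj.
Qed.

(** If a cell of [u] lies outside [s], its join with any other cell of [u] is in [u] but not in [s],
    so it lies in [t] and brings that other cell along. *)
Lemma rectangular_sub_cat u s t : rectangular u -> young s -> young t ->
  {subset u <= s ++ t} -> {subset u <= s} \/ {subset u <= t}.
Proof.
move=> ru ys yt ust.
have [/allP|/allPn[[i j] ij nij]] := boolP (all (mem s) u); first by left.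
right=> -[i' j'] ij'.
have : (maxn i i', maxn j j') \in u.
  case: (leqP i i') => _; case: (leqP j j') => _ //.
    exact: ru ij' ij.
  exact: ru ij ij'.
move=> /ust; rewrite mem_cat => /orP[h|h].
  by case/negP: nij; apply: ys h _ _; apply: leq_maxl.
by apply: yt h _ _; apply: leq_maxr.
Qed.

(** For a Young diagram [s], this is its largest Young subdiagram avoiding [p]. *)
Definition remove_above (p : cell) (s : seq cell) : seq cell :=
  [seq q <- s | ~~ ((p.1 <= q.1) && (p.2 <= q.2))].

Lemma young_remove_above p s : young s -> young (remove_above p s).
Proof.
move=> ys i j i' j'; rewrite !mem_filter /= => /andP[pij ij] ii jj.
rewrite (ys _ _ _ _ ij ii jj) andbT; apply: contra pij => /andP[pi pj].
by rewrite (leq_trans pi ii) (leq_trans pj jj).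
Qed.

Lemma remove_above_sub p s : {subset remove_above p s <= s}.
Proof. exact: mem_subseq (filter_subseq _ _). Qed.

Lemma notin_remove_above p s : p \notin remove_above p s.
Proof. by rewrite mem_filter !leqnn. Qed.

(** A cell of [s] removed from both parts would dominate [(i, j)] and [(i', j')], hence [(i, j')],
    forcing the latter into [s]. *)
Lemma sub_remove_above s i j i' j' : young s -> (i, j') \notin s ->
  {subset s <= remove_above (i, j) s ++ remove_above (i', j') s}.
Proof.
move=> ys nij [k l] kl; rewrite mem_cat !mem_filter kl !andbT /= -negb_and.
apply: contra nij => /andP[/andP[ik _] /andP[_ jl]].
exact: ys kl ik jl.
Qed.

From mathcomp Require Import boolp classical_sets cardinality.

(** * Atomicity as joint embedding *)

Section JointEmbedding.
Local Open Scope order_scope.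
Local Open Scope classical_set_scope.
Context {d : Order.disp_t} {P : porderType d}.
Implicit Types (C : set P).

Definition joint_embedding C : Prop :=
  forall x y, C x -> C y -> exists2 z, C z & x <= z /\ y <= z.

(** If [x] and [y] have no common upper bound in [C], the elements not above [x] and those not above
    [y] cover [C]. Conversely, given a cover by [D] and [E], a bound of a point outside [D] and a
    point outside [E] would lie in neither. *)
Lemma atomicP C : downward_closed C -> atomic C <-> joint_embedding C.
Proof.
move=> dC; split=> [aC x y Cx Cy|jC [D [E [dD dE [DC nDC] [EC nEC] CDE]]]].
  apply: contrapT => nz; apply: aC.
  pose below w := [set z | C z /\ ~~ (w <= z)].
  have below_dc w : downward_closed (below w).
    move=> u v [Cu wu] vu; split; first exact: dC vu.
    by apply: contra wu => wv; apply: Order.POrderTheory.le_trans vu.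
  have below_proper w : C w -> below w `<` C.
    move=> Cw; split=> [z []//|/(_ w Cw) [_]].
    by rewrite Order.POrderTheory.lexx.
  exists (below x), (below y); split; try exact: below_proper; try exact: below_dc.
  apply/seteqP; split=> [z Cz|z [[]|[]]//].
  have [xz|nxz] := boolP (x <= z); last by left.
  have [yz|nyz] := boolP (y <= z); last by right.
  by case: nz; exists z.
have /existsNP[x /not_implyP[Cx nDx]] := nDC.
have /existsNP[y /not_implyP[Cy nEy]] := nEC.
have [z + [xz yz]] := jC x y Cx Cy; rewrite CDE => -[Dz|Ez].
  exact/nDx/(dD z).
exact/nEy/(dE z).
Qed.

End JointEmbedding.

Theorem theorem4p4 (B : set eqposet) (finB : finite_set B)
    (antiB : antichain B) :
  atomic (Av B) <-> (forall b : eqposet, B b -> uniform b).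
Proof.
apply: iff_trans (atomicP (@Av_downward_closed _ _ B)) _.
split=> [jB b Bb|uB x y Bx By]; last first.
  have [s ys xE] := diagram_surj x; have [t yt yE] := diagram_surj y.
  rewrite {}xE {}yE in Bx By *.
  have yst := young_cat ys yt.
  exists (diagram (s ++ t)); last first.
    by split; apply/diagram_le => // p ps; rewrite mem_cat ps ?orbT.
  move=> b Bb; have := uB b Bb; move: (Bx b Bb) (By b Bb).
  have [u yu ->] := diagram_surj b => /negP us /negP ut.
  move=> /(diagram_uniform yu) ru.
  apply/negP => /(diagram_le yu yst)/(rectangular_sub_cat ru ys yt).
  by case=> [/(diagram_le yu ys)|/(diagram_le yu yt)].
have [u yu bE] := diagram_surj b; rewrite {}bE in Bb *.
apply/(diagram_uniform yu) => i j i' j' ij ij'; apply: contraT => nij.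
(* An element of [B] below the truncation is below [diagram u], hence equal to it by the antichain
   property, although the truncation lacks [p]. *)
have in_Av p : p \in u -> Av B (diagram (remove_above p u)).
  have yp := young_remove_above (p := p) yu.
  move=> pu c Bc; apply/negP => cp.
  have pb : (diagram (remove_above p u) <= diagram u)%O.
    by apply/(diagram_le yp yu); apply: remove_above_sub.
  have cb := antiB _ _ Bc Bb (Order.POrderTheory.le_trans cp pb).
  move: cp; rewrite cb => /(diagram_le yu yp)/(_ p pu).
  by apply/negP/notin_remove_above.
(* A common upper bound of the two truncations contains all of [u], so it cannot avoid [B]. *)
have [z Bz []] := jB _ _ (in_Av _ ij) (in_Av _ ij').
have := Bz _ Bb; have [t yt ->] := diagram_surj z => /negP ut.
move=> /(diagram_le (young_remove_above yu) yt) pt.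
move=> /(diagram_le (young_remove_above yu) yt) qt.
case: ut; apply/(diagram_le yu yt) => r /(sub_remove_above j i' yu nij).
by rewrite mem_cat => /orP[/pt|/qt].
Qed.
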